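(* Let $a>0$, $\gamma+1<0$, $\alpha>0$, $\mu_0\ge0$, $q\ge0$, $p\ge0$, $D\in\mathbb{R}$ and $E>0$. Then the (two-sided) inequality $$\frac{E}{(q+x)^{\mu}}\le S(x,a,\gamma,\alpha,\mu)\le\frac{D}{(p+x)^{\mu}}\qquad( * )$$ holds for every $\mu>\mu_0$ and every $x>0$ if and only if $0\le p\le a^{\alpha}\le q$, $D\ge D_p(a,\gamma,\alpha)$ and $0<E\le E_q(a,\gamma,\alpha)$, where $$D_p(a,\gamma,\alpha):=\sup_{x>0}e^{px}f(x,a,\gamma,\alpha),\qquad E_q(a,\gamma,\alpha):=\inf_{x>0}e^{qx}f(x,a,\gamma,\alpha).$$ In this case (for every $\mu>\mu_0$) both inequalities in $( * )$ are strict for all $x>0$, and if $p>0$ they are also strict at $x=0$. Moreover, $D_p(a,\gamma,\alpha)<+\infty$ if and only if $p\le a^{\alpha}$, and $E_q(a,\gamma,\alpha)>0$ if and only if $q\ge a^{\alpha}$. Besides, $D_p(a,\gamma,\alpha)=\zeta(-\gamma,a)$ for all $p\le a^{\alpha}$, and $E_q(a,\gamma,\alpha)=a^{\gamma}$ for $q=a^{\alpha}$.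
   Context: For $a>0$, $\gamma\in\mathbb{R}$, $\alpha>0$: $f(x,a,\gamma,\alpha)=\sum_{k=0}^{\infty}(k+a)^{\gamma}e^{-(k+a)^{\alpha}x}$ for $x>0$, and for $\mu>\max\left\{\frac{\gamma+1}{\alpha},0\right\}$ and $x\ge0$, $S(x,a,\gamma,\alpha,\mu)=\sum_{k=0}^{\infty}\frac{(k+a)^{\gamma}}{((k+a)^{\alpha}+x)^{\mu}}$ (generalized Mathieu series). $\zeta(s,a)=\sum_{k=0}^{\infty}(k+a)^{-s}$, $\operatorname{Re}s>1$, is the Hurwitz zeta function (here $-\gamma>1$). *)

(* Defs.v *)
From mathcomp Require Import all_boot all_order all_algebra.
From mathcomp Require Import all_classical all_reals all_analysis.

Set Implicit Arguments.
Unset Strict Implicit.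
Unset Printing Implicit Defensive.

Import Order.TTheory GRing.Theory Num.Theory.
Import numFieldNormedType.Exports.

Local Open Scope classical_set_scope.
Local Open Scope ring_scope.
Local Open Scope ereal_scope.

(* All the terms are nonnegative, so each series is taken in [0, +oo]: its
   value is the real sum when the series converges and +oo otherwise. *)

Definition exp_series (R : realType) (x a gamma alpha : R) : \bar R :=
  \sum_(0 <= k <oo)
    ((k%:R + a) `^ gamma * expR (- ((k%:R + a) `^ alpha * x)))%R%:E.

Definition mathieu (R : realType) (x a gamma alpha mu : R) : \bar R :=
  \sum_(0 <= k <oo)
    ((k%:R + a) `^ gamma / ((k%:R + a) `^ alpha + x) `^ mu)%R%:E.

(* Only real arguments s > 1 are needed. *)
Definition hurwitz_zeta (R : realType) (s a : R) : \bar R :=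
  \sum_(0 <= k <oo) ((k%:R + a) `^ (- s))%R%:E.

Definition Dsup (R : realType) (p a gamma alpha : R) : \bar R :=
  ereal_sup [set (expR (p * x))%:E * exp_series x a gamma alpha
            | x in [set x : R | (0 < x)%R]].

Definition Einf (R : realType) (q a gamma alpha : R) : \bar R :=
  ereal_inf [set (expR (q * x))%:E * exp_series x a gamma alpha
            | x in [set x : R | (0 < x)%R]].

(* Main.v *)
Require Import Defs.
From mathcomp Require Import all_boot all_order all_algebra.
From mathcomp Require Import all_classical all_reals all_analysis.
From mathcomp Require Import ring lra.

Set Implicit Arguments.
Unset Strict Implicit.
Unset Printing Implicit Defensive.

Import Order.TTheory GRing.Theory Num.Theory.
Import numFieldNormedType.Exports.

Local Open Scope classical_set_scope.
Local Open Scope ring_scope.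

(* Write c_k = (k + a)^gamma and t_k = (k + a)^alpha, so that the c_k are
   summable. Everything follows from the termwise bounds
     exp (mu (A - B) / A) <= (A / B)^mu <= exp (mu (A - B) / B),
   which replace the usual Laplace representation of the Mathieu series.
   With A = q + x and B = t_k + x the first one gives
   (q + x)^mu S(x) >= e^{q s} f(s) at s = mu / (q + x), hence the lower estimate;
   the upper one only needs t_k >= p. Conversely, for fixed s > 0 take
   x = 1 / h and mu = s / h: as h -> 0+ both exponential bounds converge to
   e^{(A - B) s}, and the assumed inequalities for S pass to the limit and
   become bounds on e^{q s} f(s) and e^{p s} f(s). *)

(** * Exponential bounds for powers of a ratio *)

Lemma powR_divC (R : realType) (mu A B : R) : 0 < A -> 0 < B ->
  (A / B) `^ mu = ((B / A) `^ mu)^-1.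
Proof.
by move=> A0 B0; rewrite -powRN -mulN1r powRrM powR_inv1 ?invf_div// ltW// divr_gt0.
Qed.

(** This is [ln (1 + u) <= u] at [u = (A - B) / B], where [1 + u = A / B], multiplied by [mu]. *)
Lemma powR_div_le_expR (R : realType) (mu A B : R) : 0 <= mu -> 0 < A -> 0 < B ->
  (A / B) `^ mu <= expR (mu * ((A - B) / B)).
Proof.
move=> mu0 A0 B0; have AB0 : 0 < A / B by rewrite divr_gt0.
rewrite /powR gt_eqF// ler_expR ler_wpM2l//.
have -> : A / B = 1 + (A - B) / B by field; rewrite gt_eqF.
apply: le_ln1Dx.
have -> : (A - B) / B = A / B - 1 by field; rewrite gt_eqF.
by rewrite ltrBrDl subrr.
Qed.

(** Taking inverses reduces this to the preceding upper bound with [A] and [B] exchanged. *)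
Lemma expR_le_powR_div (R : realType) (mu A B : R) : 0 <= mu -> 0 < A -> 0 < B ->
  expR (mu * ((A - B) / A)) <= (A / B) `^ mu.
Proof.
move=> mu0 A0 B0; have BA0 : 0 < B / A by rewrite divr_gt0.
rewrite powR_divC// -[leLHS]invrK -expRN.
by rewrite lef_pV2 ?posrE ?expR_gt0 ?powR_gt0// -mulrN -mulNr opprB powR_div_le_expR.
Qed.

(** Equality in [1 + u <= exp u] occurs only at [u = 0], and here [u = - (A - B) / A] is nonzero.
    This is the source of strictness in the lower estimate. *)
Lemma expR_lt_powR_div (R : realType) (mu A B : R) : 0 < mu -> 0 < A -> 0 < B ->
  A != B -> expR (mu * ((A - B) / A)) < (A / B) `^ mu.
Proof.
move=> mu0 A0 B0 AB; have BA0 : 0 < B / A by rewrite divr_gt0.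
rewrite powR_divC// -[ltLHS]invrK -expRN.
rewrite ltf_pV2 ?posrE ?expR_gt0 ?powR_gt0// -mulrN /powR gt_eqF//.
rewrite ltr_expR ltr_pM2l// -ltr_expR lnK ?posrE//.
have {1}-> : B / A = 1 + - ((A - B) / A) by field; rewrite gt_eqF.
apply: expR_gt1Dx.
by rewrite oppr_eq0 mulf_neq0 ?subr_eq0// invr_eq0 gt_eqF.
Qed.

(** * Series with nonnegative terms *)

(** Removing the [n]-th terms leaves two comparable series; the smaller one is finite, so adding
    them back does not absorb the strict gap at [n]. *)
Lemma nneseries_lt (R : realType) (u v : nat -> R) (n : nat) :
  (forall k, 0 <= u k) -> (forall k, u k <= v k) -> u n < v n ->
  (\sum_(0 <= k <oo) (u k)%:E < +oo)%E ->
  (\sum_(0 <= k <oo) (u k)%:E < \sum_(0 <= k <oo) (v k)%:E)%E.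
Proof.
move=> u0 uv uvn.
have v0 k : 0 <= v k := le_trans (u0 k) (uv k).
rewrite (@nneseriesD1 _ (fun k => (u k)%:E) n)//; last by move=> k _; rewrite lee_fin.
rewrite (@nneseriesD1 _ (fun k => (v k)%:E) n)//; last by move=> k _; rewrite lee_fin.
set U := (X in (_ + X < +oo)%E -> _); set V := (X in (_ -> (_ < _ + X))%E).
move=> Uoo.
have U0 : (0 <= U)%E by apply: nneseries_ge0 => k *; rewrite lee_fin.
have UV : (U <= V)%E by apply: lee_nneseries => k *; rewrite lee_fin.
apply: lte_leD => //.
rewrite ge0_fin_numE//; apply: le_lt_trans Uoo.
by rewrite leeDr// lee_fin.
Qed.

Lemma nneseries_le_ub (R : realType) (u : nat -> R) (M : \bar R) :
  (forall k, 0 <= u k) ->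
  (forall n, ((\sum_(0 <= k < n) u k)%:E <= M)%E) ->
  (\sum_(0 <= k <oo) (u k)%:E <= M)%E.
Proof.
move=> u0 uM; apply: lime_le.
  by apply: is_cvg_nneseries => k _ _; rewrite lee_fin.
by apply: nearW => n; rewrite sumEFin.
Qed.

Lemma sum_le_nneseries (R : realType) (u : nat -> R) n : (forall k, 0 <= u k) ->
  ((\sum_(0 <= k < n) u k)%:E <= \sum_(0 <= k <oo) (u k)%:E)%E.
Proof.
move=> u0; rewrite -sumEFin; apply: nneseries_lim_ge => k _ _.
by rewrite lee_fin.
Qed.

(** * Limits as [h] tends to 0 and as [x] tends to infinity *)

(** At [x = 1 / h] and [mu = s / h] both exponential bounds have exponents of the form
    [u k / (1 + v k * h)]: [v] is the constant [p] in the bound from below, and [v = t] in the bound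
    from above. *)
Lemma cvg_sum_expR (R : realType) (c u v : nat -> R) (n : nat) :
  \sum_(0 <= k < n) c k * expR (u k / (1 + v k * h)) @[h --> 0^'+] -->
  \sum_(0 <= k < n) c k * expR (u k).
Proof.
elim: n => [|n IH].
  by under eq_fun do rewrite big_nil; rewrite big_nil; exact: cvg_cst.
under eq_fun do rewrite big_nat_recr//=.
rewrite big_nat_recr//=; apply: cvgD => //; apply: cvgM; first exact: cvg_cst.
apply: continuous_cvg; first exact: continuous_expR.
rewrite -[X in _ --> X]divr1; apply: cvgM; first exact: cvg_cst.
apply: cvgV; first exact: oner_neq0.
rewrite [X in _ --> X](_ : 1 = 1 + v n * 0); last by rewrite mulr0 addr0.
apply: cvgD; first exact: cvg_cst.
by apply: cvgM; [exact: cvg_cst | exact: cvg_within].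
Qed.

(** Letting [x] grow removes the exponential term; this serves to evaluate infima that are
    approached as [x] tends to infinity. *)
Lemma le_expR_decay (R : realType) (y : \bar R) (l M d : R) : 0 < d -> 0 <= M ->
  (forall x, 0 < x -> (y <= (l + expR (- (d * x)) * M)%:E)%E) -> (y <= l%:E)%E.
Proof.
move=> d0 M0 yle; apply/lee_addgt0Pr => e e0.
(* With this value of [x], [d * x = (M + 1) / e], hence [e * exp (d * x) >= e + M + 1 > M]. *)
have x0 : 0 < (M + 1) / (e * d) by rewrite divr_gt0 ?mulr_gt0// ltr_wpDl.
apply: le_trans (yle _ x0) _; rewrite -EFinD lee_fin lerD2l.
have -> : d * ((M + 1) / (e * d)) = (M + 1) / e.
  by field; rewrite !gt_eqF.
rewrite expRN mulrC ler_pdivrMr ?expR_gt0//.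
apply: le_trans (_ : e * (1 + (M + 1) / e) <= _).
  have -> : e * (1 + (M + 1) / e) = e + M + 1 by field; rewrite gt_eqF.
  lra.
by rewrite ler_pM2l// expR_ge1Dx.
Qed.

(** * Convergence of the series of coefficients *)

Lemma summable_powR (R : realType) (a gamma : R) : 0 < a -> gamma + 1 < 0 ->
  (\sum_(0 <= k <oo) ((k%:R + a) `^ gamma)%:E < +oo)%E.
Proof.
move=> a0 gamma1.
have [d d0 gammaE] : exists2 d, 0 < d & gamma = - d + -1.
  by exists (- (gamma + 1)); [rewrite oppr_gt0 | ring].
have z0 k : 0 < k%:R + a by rewrite ltr_wpDl.
(* The convexity bound [1 + d / z <= (z / y) `^ d] lets the series telescope. *)
have step k : d * (k.+1%:R + a) `^ gamma <=
    (k%:R + a) `^ (- d) - (k.+1%:R + a) `^ (- d).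
  set z := k.+1%:R + a; set y := k%:R + a.
  have [y0 zz0] : 0 < y /\ 0 < z by split; exact: z0.
  have zE : z - y = 1 by rewrite /z /y -natr1; ring.
  have yE : y `^ (- d) = z `^ (- d) * (z / y) `^ d.
    rewrite !powRN [in RHS](_ : z `^ d = y `^ d * (z / y) `^ d).
      by rewrite invfM mulfVK// gt_eqF// powR_gt0 ?divr_gt0.
    by rewrite -powRM ?divr_ge0 ?ltW// mulrC divfK// gt_eqF.
  rewrite {1}gammaE powRD; last by rewrite (gt_eqF zz0) implybT.
  rewrite (powR_inv1 (ltW zz0)) yE.
  rewrite [leLHS]mulrCA -[X in _ <= _ - X]mulr1 -mulrBr ler_pM2l ?powR_gt0// lerBrDl.
  apply: le_trans (expR_le_powR_div (ltW d0) zz0 y0).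
  by rewrite zE mul1r expR_ge1Dx.
have tele n : d * \sum_(0 <= k < n) (k.+1%:R + a) `^ gamma <= a `^ (- d).
  rewrite mulr_sumr; apply: le_trans (ler_sum _ (fun k _ => step k)) _.
  under eq_bigr do rewrite -opprB.
  rewrite sumrN (telescope_sumr (fun k => (k%:R + a) `^ (- d)))//.
  by rewrite add0r opprB gerBl powR_ge0.
apply: (@le_lt_trans _ _ (a `^ gamma + a `^ (- d) / d)%:E); last exact: ltry.
apply: nneseries_le_ub => [k|n]; first exact: powR_ge0.
(* The telescoping bound controls only the terms from index 1 on, so one term is added at the end
   and the term of index 0 is split off. *)
rewrite lee_fin; apply: (@le_trans _ _ (\sum_(0 <= k < n.+1) (k%:R + a) `^ gamma)).
  by rewrite [leRHS]big_nat_recr//= lerDl powR_ge0.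
by rewrite big_nat_recl//= add0r lerD2l ler_pdivlMr// mulrC.
Qed.

(** * Suprema and infima of exponential sums *)

(** All exponents are nonpositive, which gives the upper bound. The supremum is approached as [x]
    tends to 0: [exp u >= 1 + u] bounds each partial sum below by [A - B * x]. *)
Lemma ereal_sup_expR_sumE (R : realType) (c t : nat -> R) (p : R) :
  (forall k, 0 <= c k) -> (forall k, p <= t k) ->
  ereal_sup [set \sum_(0 <= k <oo) (c k * expR ((p - t k) * x))%:E
            | x in [set x : R | (0 < x)%R]]%E = (\sum_(0 <= k <oo) (c k)%:E)%E.
Proof.
move=> c0 pt; apply/eqP; rewrite eq_le; apply/andP; split.
  apply: ge_ereal_sup => _ [x /= x0 <-]; apply: lee_nneseries => k *.
    by rewrite lee_fin mulr_ge0 ?expR_ge0.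
  rewrite lee_fin ler_piMr// -expR0 ler_expR mulr_le0_ge0 ?(ltW x0)// subr_le0.
  exact: pt.
apply: nneseries_le_ub => // n.
set S := ereal_sup _.
pose A := \sum_(0 <= k < n) c k.
pose B := \sum_(0 <= k < n) c k * (t k - p).
have B0 : 0 <= B by apply: sumr_ge0 => k _; rewrite mulr_ge0 ?subr_ge0.
have key x : 0 < x -> ((A - B * x)%:E <= S)%E.
  move=> x0; apply: le_trans (ereal_sup_ubound _); last by exists x.
  apply: le_trans (sum_le_nneseries n _); last by move=> k; rewrite mulr_ge0 ?expR_ge0.
  rewrite lee_fin /A /B mulr_suml -sumrB; apply: ler_sum => k _.
  have -> : c k - c k * (t k - p) * x = c k * (1 + (p - t k) * x) by ring.
  by rewrite ler_wpM2l ?expR_ge1Dx.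
apply/lee_addgt0Pr => e e0; rewrite -/A.
(* This choice makes [B * x <= e]; the [+ 1] covers [B = 0]. *)
have x0 : 0 < e / (B + 1) by rewrite divr_gt0 ?ltr_wpDl.
rewrite -leeBlDr// -EFinB; apply: le_trans (key _ x0); rewrite lee_fin lerD2l lerN2.
rewrite mulrA ler_pdivrMr ?ltr_wpDl//; nra.
Qed.

(** The term of index 0 alone is unbounded: by [exp u >= 1 + u] it exceeds [M] once
    [c 0 * (p - t 0) * x = M]. *)
Lemma ereal_sup_expR_sum_pinfty (R : realType) (c t : nat -> R) (p : R) :
  (forall k, 0 <= c k) -> 0 < c 0%N -> t 0%N < p ->
  ereal_sup [set \sum_(0 <= k <oo) (c k * expR ((p - t k) * x))%:E
            | x in [set x : R | (0 < x)%R]]%E = +oo%E.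
Proof.
move=> c0 c00 tp; apply/eqyP => M M0.
have d0 : 0 < p - t 0%N by rewrite subr_gt0.
pose x := M / (c 0%N * (p - t 0%N)).
have x0 : 0 < x by rewrite divr_gt0 ?mulr_gt0.
apply: le_trans (ereal_sup_ubound _); last by exists x.
apply: le_trans (sum_le_nneseries 1 _); last by move=> k; rewrite mulr_ge0 ?expR_ge0.
rewrite big_nat1 lee_fin -ler_pdivrMl//; apply: le_trans (expR_ge1Dx _).
rewrite [X in 1 + X](_ : _ = (c 0%N)^-1 * M) ?lerDr ?ler01//.
by rewrite /x; field; rewrite !gt_eqF.
Qed.

(** Since [t 0] is the least exponent, the whole sum is at most [exp (- (t 0 - q) * x)] times the
    sum of the [c k]. *)
Lemma ereal_inf_expR_sumE0 (R : realType) (c t : nat -> R) (q : R) :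
  (forall k, 0 <= c k) -> (\sum_(0 <= k <oo) (c k)%:E < +oo)%E ->
  (forall k, t 0%N <= t k) -> q < t 0%N ->
  ereal_inf [set \sum_(0 <= k <oo) (c k * expR ((q - t k) * x))%:E
            | x in [set x : R | (0 < x)%R]]%E = 0%E.
Proof.
move=> c0 coo t0 qt; apply/eqP; rewrite eq_le; apply/andP; split; last first.
  apply: le_ereal_inf_tmp => _ [x /= x0 <-]; apply: nneseries_ge0 => k *.
  by rewrite lee_fin mulr_ge0 ?expR_ge0.
have d0 : 0 < t 0%N - q by rewrite subr_gt0.
have S0 : (0 <= \sum_(0 <= k <oo) (c k)%:E)%E.
  by apply: nneseries_ge0 => k *; rewrite lee_fin.
apply: (@le_expR_decay _ _ 0 (fine (\sum_(0 <= k <oo) (c k)%:E)%E) _ d0).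
  exact: fine_ge0.
move=> x x0; rewrite add0r EFinM fineK ?ge0_fin_numE//.
apply: le_trans (ereal_inf_lbound _) _; first by exists x.
rewrite -nneseriesZl; last by move=> k _; rewrite lee_fin.
apply: lee_nneseries => k *; first by rewrite lee_fin mulr_ge0 ?expR_ge0.
rewrite -EFinM lee_fin mulrC ler_wpM2r// ler_expR -mulNr (ler_wpM2r (ltW x0))// opprB.
by rewrite lerD2l lerN2.
Qed.

(** The term of index 0 is constantly [c 0], while all others decay at least at the common rate
    [t 1 - t 0 > 0]. *)
Lemma ereal_inf_expR_sumE (R : realType) (c t : nat -> R) :
  (forall k, 0 <= c k) -> (\sum_(0 <= k <oo) (c k)%:E < +oo)%E ->
  t 0%N < t 1%N -> (forall k, (0 < k)%N -> t 1%N <= t k) ->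
  ereal_inf [set \sum_(0 <= k <oo) (c k * expR ((t 0%N - t k) * x))%:E
            | x in [set x : R | (0 < x)%R]]%E = (c 0%N)%:E.
Proof.
move=> c0 coo t01 t1; apply/eqP; rewrite eq_le; apply/andP; split; last first.
  apply: le_ereal_inf_tmp => _ [x /= x0 <-].
  apply: le_trans (sum_le_nneseries 1 _); last by move=> k; rewrite mulr_ge0 ?expR_ge0.
  by rewrite big_nat1 subrr mul0r expR0 mulr1.
have d0 : 0 < t 1%N - t 0%N by rewrite subr_gt0.
have S0 : (0 <= \sum_(0 <= k <oo) (c k)%:E)%E.
  by apply: nneseries_ge0 => k *; rewrite lee_fin.
apply: (@le_expR_decay _ _ _ (fine (\sum_(0 <= k <oo) (c k)%:E)%E) _ d0).
  exact: fine_ge0.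
move=> x x0; rewrite EFinD EFinM fineK ?ge0_fin_numE//.
apply: le_trans (ereal_inf_lbound _) _; first by exists x.
rewrite (@nneseriesD1 _ (fun k => (c k * expR ((t 0%N - t k) * x))%:E) 0)//; last first.
  by move=> k _; rewrite lee_fin mulr_ge0 ?expR_ge0.
rewrite subrr mul0r expR0 mulr1 leeD2l//.
rewrite -nneseriesZl; last by move=> k _; rewrite lee_fin.
(* The omitted index 0 is restored with a zero term, so that the comparison with the full series of
   the [c k] is termwise. *)
rewrite eseries_mkcond; apply: lee_nneseries => k *.
  by case: ifP => // _; rewrite lee_fin mulr_ge0 ?expR_ge0.
case: ifP => [/= k0|_]; last by rewrite -EFinM lee_fin mulr_ge0 ?expR_ge0.
rewrite -EFinM lee_fin mulrC ler_wpM2r// ler_expR -mulNr (ler_wpM2r (ltW x0))// opprB.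
by rewrite lerD2l lerN2 t1// lt0n.
Qed.

(** * Transfer between power series terms and exponential terms *)

(* The terms are rescaled by [A ^ mu] so that they only involve the ratio
   [A / (t k + x)], which the two exponential bounds above control. *)
Lemma nneseries_div_powR (R : realType) (c t : nat -> R) (A x mu : R) :
  0 < A -> (forall k, 0 <= c k) -> (forall k, 0 < t k + x) ->
  (\sum_(0 <= k <oo) (c k * (A / (t k + x)) `^ mu)%:E =
   (A `^ mu)%:E * \sum_(0 <= k <oo) (c k / (t k + x) `^ mu)%:E)%E.
Proof.
move=> A0 c0 t0; rewrite -nneseriesZl; last first.
  by move=> k _; rewrite lee_fin divr_ge0 ?powR_ge0.
apply: eq_eseriesr => k _; rewrite -EFinM; congr _%:E.
rewrite mulrCA powRM ?ltW// ?invr_gt0//; congr (_ * (_ * _)).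
by rewrite -powR_inv1 ?ltW// -powRrM mulN1r powRN.
Qed.

(** By nonnegativity it suffices to bound partial sums. Each is a limit of finite sums which
    [expR_le_powR_div] puts below the rescaled series at [x = 1 / h], [mu = s / h]. *)
Lemma nneseries_expR_le (R : realType) (c t : nat -> R) (p mu0 D : R) :
  0 <= p -> 0 <= mu0 -> (forall k, 0 <= c k) -> (forall k, 0 < t k) ->
  (forall mu x, mu0 < mu -> 0 < x ->
    (\sum_(0 <= k <oo) (c k * ((p + x) / (t k + x)) `^ mu)%:E <= D%:E)%E) ->
  forall s, 0 < s ->
    (\sum_(0 <= k <oo) (c k * expR ((p - t k) * s))%:E <= D%:E)%E.
Proof.
move=> p0 mu00 c0 t0 H s s0.
apply: nneseries_le_ub => [k|n]; first by rewrite mulr_ge0 ?expR_ge0.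
have := @cvg_sum_expR _ c (fun k => (p - t k) * s) (fun=> p) n.
move=> cv; rewrite lee_fin -(cvg_lim _ cv)//; apply: limr_le; first exact: cvgP cv.
near=> h.
have h0 : 0 < h by near: h; exact: nbhs_right_gt.
(* This guarantees [s / h > mu0]; the [+ 1] keeps the denominator positive when [mu0 = 0]. *)
have hs : h < s / (mu0 + 1).
  by near: h; apply: nbhs_right_lt; rewrite divr_gt0// ltr_wpDl.
have mu0s : mu0 < s / h.
  rewrite ltr_pdivlMr//; move: hs; rewrite ltr_pdivlMr ?ltr_wpDl//; nra.
have x0 : 0 < h^-1 by rewrite invr_gt0.
rewrite -lee_fin; apply: le_trans (H _ _ mu0s x0).
apply: le_trans (sum_le_nneseries n _); last by move=> k; rewrite mulr_ge0 ?powR_ge0.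
rewrite lee_fin; apply: ler_sum => k _; rewrite ler_wpM2l//.
have px0 : 0 < p + h^-1 by rewrite ltr_wpDl.
have tx0 : 0 < t k + h^-1 by rewrite addr_gt0.
apply: le_trans (expR_le_powR_div (ltW (le_lt_trans mu00 mu0s)) px0 tx0).
have -> : (p - t k) * s / (1 + p * h) =
          s / h * ((p + h^-1 - (t k + h^-1)) / (p + h^-1)).
  by field; rewrite !gt_eqF//= ltr_wpDl ?mulr_ge0// ltW.
by [].
Unshelve. all: by end_near. Qed.

(** Here truncation goes the wrong way, so the tail is bounded uniformly in [h] by [exp (q * s)]
    times the tail of the [c k]. First [h] tends to 0 with [n] fixed, then [n] tends to infinity. *)
Lemma le_nneseries_expR (R : realType) (c t : nat -> R) (q mu0 E : R) :
  0 <= q -> 0 <= mu0 -> (forall k, 0 <= c k) -> (forall k, 0 < t k) ->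
  (\sum_(0 <= k <oo) (c k)%:E < +oo)%E ->
  (forall mu x, mu0 < mu -> 0 < x ->
    (E%:E <= \sum_(0 <= k <oo) (c k * ((q + x) / (t k + x)) `^ mu)%:E)%E) ->
  forall s, 0 < s ->
    (E%:E <= \sum_(0 <= k <oo) (c k * expR ((q - t k) * s))%:E)%E.
Proof.
move=> q0 mu00 c0 t0 coo H s s0; set S := (X in (_ <= X)%E).
have cE0 k : true -> (0 <= (c k)%:E)%E by rewrite lee_fin.
have tail n : (E%:E <= S + (expR (q * s))%:E * \sum_(n <= k <oo) (c k)%:E)%E.
  have tail0 : (0 <= \sum_(n <= k <oo) (c k)%:E)%E.
    by apply: nneseries_ge0 => k *; rewrite lee_fin.
  have tailoo : (\sum_(n <= k <oo) (c k)%:E < +oo)%E.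
    apply: le_lt_trans coo; rewrite (@nneseries_split _ _ 0 n)// add0n.
    by rewrite leeDr// sume_ge0// => k _; rewrite lee_fin.
  rewrite -leeBlDr; last by rewrite fin_numM// ge0_fin_numE.
  apply: le_trans (sum_le_nneseries n _); last by move=> k; rewrite mulr_ge0 ?expR_ge0.
  have tailE : (\sum_(n <= k <oo) (c k)%:E =
                (fine (\sum_(n <= k <oo) (c k)%:E))%:E)%E.
    by rewrite fineK// ge0_fin_numE.
  rewrite tailE -EFinM -EFinB lee_fin; set T := fine _.
  have := @cvg_sum_expR _ c (fun k => (q - t k) * s) t n.
  move=> cv; rewrite -(cvg_lim _ cv)//; apply: limr_ge; first exact: cvgP cv.
  near=> h.
  have h0 : 0 < h by near: h; exact: nbhs_right_gt.
  have hs : h < s / (mu0 + 1).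
    by near: h; apply: nbhs_right_lt; rewrite divr_gt0// ltr_wpDl.
  have mu0s : mu0 < s / h.
    rewrite ltr_pdivlMr//; move: hs; rewrite ltr_pdivlMr ?ltr_wpDl//; nra.
  have x0 : 0 < h^-1 by rewrite invr_gt0.
  have qx0 : 0 < q + h^-1 by rewrite ltr_wpDl.
  have term k : ((q + h^-1) / (t k + h^-1)) `^ (s / h) <=
      expR ((q - t k) * s / (1 + t k * h)).
    have tx0 : 0 < t k + h^-1 by rewrite addr_gt0.
    apply: le_trans (powR_div_le_expR (ltW (le_lt_trans mu00 mu0s)) qx0 tx0) _.
    rewrite (_ : s / h * _ = (q - t k) * s / (1 + t k * h))//.
    by field; rewrite !gt_eqF//= addr_gt0// mulr_gt0.
  rewrite lerBlDr -lee_fin; apply: le_trans (H _ _ mu0s x0) _.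
  rewrite (@nneseries_split _ _ 0 n); last first.
    by move=> k _; rewrite lee_fin mulr_ge0 ?powR_ge0.
  rewrite add0n EFinD sumEFin; apply: leeD.
    by rewrite lee_fin; apply: ler_sum => k _; rewrite ler_wpM2l.
  rewrite EFinM -tailE -nneseriesZl//.
  apply: lee_nneseries => k *; first by rewrite lee_fin mulr_ge0 ?powR_ge0.
  rewrite -EFinM lee_fin mulrC ler_wpM2r//; apply: le_trans (term k) _.
  (* The exponent is at most [q * s] for all [k] and [h]: after clearing the denominator the
     difference is a sum of nonnegative products. *)
  rewrite ler_expR ler_pdivrMr; last by rewrite addr_gt0// mulr_gt0.
  rewrite -subr_ge0 (_ : _ - _ = t k * s + q * s * (t k * h)); last by ring.
  by have tk0 := ltW (t0 k); rewrite addr_ge0 ?mulr_ge0// ltW.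
have : (S + (expR (q * s))%:E * \sum_(n <= k <oo) (c k)%:E @[n --> \oo] --> S)%E.
  rewrite [X in _ --> X](_ : S = S + (expR (q * s))%:E * 0)%E; last first.
    by rewrite mule0 adde0.
  apply: cvgeD; last by apply: cvgeZl => //; exact: (nneseries_tail_cvg coo cE0).
    by rewrite fin_num_adde_defl// mule0.
  exact: cvg_cst.
move=> cv; rewrite -(cvg_lim _ cv)//; apply: lime_ge; first exact: cvgP cv.
exact: nearW.
Unshelve. all: by end_near. Qed.

(** Every ratio is at most 1 because [p <= t k], and the ratio of index [n] is strictly smaller. *)
Lemma nneseries_powR_div_lt (R : realType) (c t : nat -> R) (p x mu : R) n :
  0 < mu -> 0 < p + x -> (forall k, 0 < c k) -> (forall k, p <= t k) -> p < t n ->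
  (\sum_(0 <= k <oo) (c k)%:E < +oo)%E ->
  (\sum_(0 <= k <oo) (c k * ((p + x) / (t k + x)) `^ mu)%:E <
   \sum_(0 <= k <oo) (c k)%:E)%E.
Proof.
move=> mu0 px0 c0 pt ptn coo.
have c0W k : 0 <= c k := ltW (c0 k).
have tx0 k : 0 < t k + x by rewrite (lt_le_trans px0)// lerD2r.
have ratio0 k : 0 <= (p + x) / (t k + x) by rewrite divr_ge0 ?(ltW px0) ?ltW.
have le1 k : c k * ((p + x) / (t k + x)) `^ mu <= c k.
  rewrite ler_piMr// -[leRHS](powRr0 ((p + x) / (t k + x))).
  by rewrite ger_powR ?(ltW mu0)// divr_gt0//= ler_pdivrMr// mul1r lerD2r.
have u0 k : 0 <= c k * ((p + x) / (t k + x)) `^ mu by rewrite mulr_ge0 ?powR_ge0.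
apply: (@nneseries_lt _ _ c n) => //; last first.
  by apply: le_lt_trans coo; apply: lee_nneseries => k *; rewrite lee_fin.
rewrite gtr_pMr//; apply: (@lt_le_trans _ _ (1 `^ mu)); last by rewrite powR1.
rewrite gt0_ltr_powR ?nnegrE//.
by rewrite ltr_pdivrMr// mul1r ltrD2r.
Qed.

(** At [s = mu / (q + x)] the exponents are exactly those of [expR_le_powR_div], and the bound is
    strict at any index with [t n != q]. *)
Lemma nneseries_lt_powR_div (R : realType) (c t : nat -> R) (q x mu E : R) n :
  0 < mu -> 0 < q + x -> (forall k, 0 < c k) -> (forall k, 0 < t k + x) ->
  t n != q ->
  (E%:E <= \sum_(0 <= k <oo) (c k * expR ((q - t k) * (mu / (q + x))))%:E)%E ->
  (E%:E < \sum_(0 <= k <oo) (c k * ((q + x) / (t k + x)) `^ mu)%:E)%E.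
Proof.
move=> mu0 qx0 c0 tx0 tnq EE.
have c0W k : 0 <= c k := ltW (c0 k).
have argE k : (q - t k) * (mu / (q + x)) = mu * ((q + x - (t k + x)) / (q + x)).
  by field; rewrite gt_eqF.
have u0 k : 0 <= c k * expR ((q - t k) * (mu / (q + x))).
  by rewrite mulr_ge0 ?expR_ge0.
have uv k : c k * expR ((q - t k) * (mu / (q + x))) <=
    c k * ((q + x) / (t k + x)) `^ mu.
  by rewrite ler_wpM2l// argE expR_le_powR_div// ltW.
(* An infinite right-hand side exceeds the real [E] at once; otherwise the exponential series is
   finite too, as strict comparison requires. *)
have [/eqP ->|voo] := boolP (\sum_(0 <= k <oo)
    (c k * ((q + x) / (t k + x)) `^ mu)%:E == +oo)%E; first exact: ltry.
apply: le_lt_trans EE _; apply: (@nneseries_lt _ _ _ n) => //.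
  rewrite ltr_pM2l// argE expR_lt_powR_div//.
  by rewrite (inj_eq (addIr x)) eq_sym.
apply: le_lt_trans (_ : _ < +oo)%E; last by rewrite ltey; exact: voo.
by apply: lee_nneseries => k *; rewrite lee_fin.
Qed.

(** * The constants [Dsup] and [Einf] as extrema of exponential sums *)

Lemma expR_mul_exp_series (R : realType) (p x a gamma alpha : R) :
  ((expR (p * x))%:E * exp_series x a gamma alpha =
   \sum_(0 <= k <oo)
     ((k%:R + a) `^ gamma * expR ((p - (k%:R + a) `^ alpha) * x))%:E)%E.
Proof.
rewrite /exp_series -nneseriesZl; last first.
  by move=> k _; rewrite lee_fin mulr_ge0 ?powR_ge0 ?expR_ge0.
apply: eq_eseriesr => k _; rewrite -EFinM mulrCA -expRD; congr (_ * expR _)%:E.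
by rewrite mulrBl.
Qed.

Lemma DsupE (R : realType) (p a gamma alpha : R) :
  Dsup p a gamma alpha =
  ereal_sup [set \sum_(0 <= k <oo)
      ((k%:R + a) `^ gamma * expR ((p - (k%:R + a) `^ alpha) * x))%:E
    | x in [set x : R | (0 < x)%R]]%E.
Proof.
congr ereal_sup; apply: eq_imagel => x _; exact: expR_mul_exp_series.
Qed.

Lemma EinfE (R : realType) (q a gamma alpha : R) :
  Einf q a gamma alpha =
  ereal_inf [set \sum_(0 <= k <oo)
      ((k%:R + a) `^ gamma * expR ((q - (k%:R + a) `^ alpha) * x))%:E
    | x in [set x : R | (0 < x)%R]]%E.
Proof.
congr ereal_inf; apply: eq_imagel => x _; exact: expR_mul_exp_series.
Qed.

(** * The two-sided estimate and its optimal constants *)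

Theorem theorem2p2 (R : realType) (a gamma alpha mu0 q p D E : R)
    (a_gt0 : 0 < a) (gamma_lt : gamma + 1 < 0) (alpha_gt0 : 0 < alpha)
    (mu0_ge0 : 0 <= mu0) (q_ge0 : 0 <= q) (p_ge0 : 0 <= p) (E_gt0 : 0 < E) :
  [/\ (forall mu x : R, mu0 < mu -> 0 < x ->
         ((E / (q + x) `^ mu)%:E <= mathieu x a gamma alpha mu
                                 <= (D / (p + x) `^ mu)%:E)%E)
      <-> [/\ 0 <= p <= a `^ alpha, a `^ alpha <= q,
              (Dsup p a gamma alpha <= D%:E)%E,
              0 < E & (E%:E <= Einf q a gamma alpha)%E],
      [/\ 0 <= p <= a `^ alpha, a `^ alpha <= q,
          (Dsup p a gamma alpha <= D%:E)%E,
          0 < E & (E%:E <= Einf q a gamma alpha)%E] ->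
        forall mu x : R, mu0 < mu -> (0 < x \/ (0 < p /\ x = 0)) ->
          ((E / (q + x) `^ mu)%:E < mathieu x a gamma alpha mu
                                  < (D / (p + x) `^ mu)%:E)%E,
      ((Dsup p a gamma alpha < +oo)%E <-> p <= a `^ alpha)
        /\ ((0 < Einf q a gamma alpha)%E <-> a `^ alpha <= q),
      p <= a `^ alpha -> Dsup p a gamma alpha = hurwitz_zeta (- gamma) a
    & q = a `^ alpha -> Einf q a gamma alpha = (a `^ gamma)%:E].
Proof.
have z0 k : 0 < k%:R + a by rewrite ltr_wpDl.
pose c k := (k%:R + a) `^ gamma; pose t k := (k%:R + a) `^ alpha.
have c_gt0 k : 0 < c k by exact: powR_gt0.
have c_ge0 k : 0 <= c k := ltW (c_gt0 k).
have t_gt0 k : 0 < t k by exact: powR_gt0.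
have coo : (\sum_(0 <= k <oo) (c k)%:E < +oo)%E by exact: summable_powR.
have tlt i j : (i < j)%N -> t i < t j.
  by move=> ij; rewrite gt0_ltr_powR ?nnegrE ?(ltW (z0 _))// ltrD2r ltr_nat.
have tle i j : (i <= j)%N -> t i <= t j.
  by rewrite leq_eqVlt => /predU1P[->//|/tlt/ltW].
have t0E : t 0%N = a `^ alpha by rewrite /t add0r.
have c0E : c 0%N = a `^ gamma by rewrite /c add0r.
have DsupE1 : p <= a `^ alpha -> Dsup p a gamma alpha = hurwitz_zeta (- gamma) a.
  move=> pa; rewrite DsupE (@ereal_sup_expR_sumE _ c t)//; last first.
    by move=> k; rewrite (le_trans pa)// -t0E tle.
  by rewrite /hurwitz_zeta opprK.
have EinfE1 : q = a `^ alpha -> Einf q a gamma alpha = (a `^ gamma)%:E.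
  move=> ->; rewrite EinfE -t0E -c0E.
  apply: (@ereal_inf_expR_sumE _ c t) => //; first exact: tlt.
  by move=> k; exact: tle.
have zetaoo : (hurwitz_zeta (- gamma) a < +oo)%E by rewrite /hurwitz_zeta opprK.
have Dfin : (Dsup p a gamma alpha < +oo)%E <-> p <= a `^ alpha.
  split=> [|pa]; last by rewrite DsupE1.
  apply: contraPT; rewrite -ltNge -t0E => tp.
  by rewrite DsupE (@ereal_sup_expR_sum_pinfty _ c t)// ltxx.
have Epos : (0 < Einf q a gamma alpha)%E <-> a `^ alpha <= q.
  split=> [|aq].
    apply: contraPT; rewrite -ltNge -t0E => qt.
    by rewrite EinfE (@ereal_inf_expR_sumE0 _ c t) ?ltxx// => k; exact: tle.
  (* The term of index 0 has a nonnegative exponent, so every sum is at least [c 0], a positive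
     bound independent of [x]. *)
  apply: (@lt_le_trans _ _ (c 0%N)%:E); first by rewrite lte_fin.
  rewrite EinfE; apply: le_ereal_inf_tmp => _ [x /= x0 <-].
  apply: le_trans (@sum_le_nneseries _ (fun k => c k * expR ((q - t k) * x)) 1 _).
    rewrite big_nat1 lee_fin ler_peMr// -expR0 ler_expR mulr_ge0 ?(ltW x0)//.
    by rewrite subr_ge0 t0E.
  by move=> k; rewrite mulr_ge0 ?expR_ge0.
(* The strict estimates come first; sufficiency in the equivalence follows by weakening them. *)
have strict : [/\ 0 <= p <= a `^ alpha, a `^ alpha <= q,
    (Dsup p a gamma alpha <= D%:E)%E,
    0 < E & (E%:E <= Einf q a gamma alpha)%E] ->
  forall mu x : R, mu0 < mu -> (0 < x \/ (0 < p /\ x = 0)) ->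
    ((E / (q + x) `^ mu)%:E < mathieu x a gamma alpha mu
                            < (D / (p + x) `^ mu)%:E)%E.
  move=> [/andP[_ pa] aq DD _ EE] mu x mu0mu x_cases.
  have mu_gt0 : 0 < mu := le_lt_trans mu0_ge0 mu0mu.
  have x0 : 0 <= x by case: x_cases => [/ltW|[_ ->]].
  have px0 : 0 < p + x.
    by case: x_cases => [x_gt0|[p_gt0 ->]]; rewrite ?addr0// ltr_wpDl.
  have tx0 k : 0 < t k + x by rewrite ltr_wpDr.
  have qx0 : 0 < q + x by rewrite ltr_wpDr// (lt_le_trans _ aq)// -t0E.
  apply/andP; split.
    rewrite EFinM muleC lte_pdivrMl ?powR_gt0//.
    rewrite -(@nneseries_div_powR _ c t)//.
    (* [q] may equal [t 0], but then [t 1 > q]. *)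
    have [n tnq] : exists n, t n != q.
      have [t0q|] := eqVneq (t 0%N) q; last by exists 0%N.
      by exists 1%N; rewrite -t0q gt_eqF// tlt.
    apply: (@nneseries_lt_powR_div _ c t _ _ _ _ n) => //.
    apply: le_trans EE _; rewrite EinfE; apply: ereal_inf_lbound.
    by exists (mu / (q + x)) => //=; rewrite divr_gt0.
  rewrite EFinM muleC lte_pdivlMl ?powR_gt0// -(@nneseries_div_powR _ c t)//.
  apply: lt_le_trans DD; rewrite DsupE1// /hurwitz_zeta opprK.
  (* Index 1 is used because [p = t 0] is possible, whereas [p <= t 0 < t 1]. *)
  apply: (@nneseries_powR_div_lt _ c t _ _ _ 1) => //.
    by move=> k; rewrite (le_trans pa)// -t0E tle.
  by rewrite (le_lt_trans pa)// -t0E tlt.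
split => //; split => [H|cond mu x mu0mu x0]; last first.
  by have /andP[/ltW -> /ltW ->] := strict cond mu x mu0mu (or_introl x0).
have tx0 x : 0 < x -> forall k, 0 < t k + x by move=> x0 k; rewrite addr_gt0.
have DD : (Dsup p a gamma alpha <= D%:E)%E.
  rewrite DsupE; apply: ge_ereal_sup => _ [s /= s0 <-].
  apply: (@nneseries_expR_le _ c t p mu0) => // mu x mu0mu x0.
  have px0 : 0 < p + x by rewrite ltr_wpDl.
  have /andP[_] := H mu x mu0mu x0.
  rewrite (nneseries_div_powR _ px0)//; last exact: tx0.
  by rewrite EFinM muleC lee_pdivlMl ?powR_gt0.
have EE : (E%:E <= Einf q a gamma alpha)%E.
  rewrite EinfE; apply: le_ereal_inf_tmp => _ [s /= s0 <-].
  apply: (@le_nneseries_expR _ c t q mu0) => // mu x mu0mu x0.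
  have qx0 : 0 < q + x by rewrite ltr_wpDl.
  have /andP[+ _] := H mu x mu0mu x0.
  rewrite (nneseries_div_powR _ qx0)//; last exact: tx0.
  by rewrite EFinM muleC lee_pdivrMl ?powR_gt0.
(* The conditions on [p] and [q] come last: [Dsup] is finite, being at most [D], and [Einf] is
   positive, being at least [E]. *)
split => //; first by rewrite p_ge0; apply/Dfin; exact: le_lt_trans DD (ltry _).
by apply/Epos; apply: lt_le_trans EE; rewrite lte_fin.
Qed.
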